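(* If the local rule table of a radius one sand automaton $\Phi:X\to X$ is a Latin square, then $\Phi$ is not equicontinuous.
   Context: Let $\widetilde{\mathbb{Z}}=\mathbb{Z}\cup\{-\infty,+\infty\}$ and $X=\widetilde{\mathbb{Z}}^{\mathbb{Z}}$. For $m\in\mathbb{Z}$, $n\in\widetilde{\mathbb{Z}}$ let $\beta_1^m(n)=+\infty$ if $n>m+1$, $-\infty$ if $n<m-1$, and $n-m$ otherwise, so $\beta_1^m(n)\in\widetilde{\mathcal{A}}_1=\{-\infty,-1,0,1,\infty\}$. A radius one sand automaton with local rule $\phi:\widetilde{\mathcal{A}}_1^{2}\to\{-2,-1,0,1,2\}$ is the map $\Phi:X\to X$ with $\Phi(\mathbf{x})_i=x_i$ if $x_i=\pm\infty$ and $\Phi(\mathbf{x})_i=x_i+\phi(\beta_1^{x_i}(x_{i-1}),\beta_1^{x_i}(x_{i+1}))$ if $x_i\in\mathbb{Z}$. Its local rule table is the $5\times5$ table with rows indexed by $L\in\widetilde{\mathcal{A}}_1$, columns by $R\in\widetilde{\mathcal{A}}_1$, and entry $\phi(L,R)$. It is a Latin square if each element of $\{-2,-1,0,1,2\}$ occurs exactly once in each row and exactly once in each column. Topology on $X$: let $e:X\to\{0,1\}^{\mathbb{Z}^2}$ be the injection with $(e(\mathbf{x}))_{i,j}=1$ if $j\le x_i$ and $0$ if $j>x_i$. $X$ carries the topology making $e$ a homeomorphism onto its (compact) image, where $\{0,1\}^{\mathbb{Z}^2}$ has the product topology; let $d$ be a compatible metric (by compactness the choice is immaterial). $\Phi$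 is equicontinuous if at every $x\in X$: for every $\epsilon>0$ there is $\delta>0$ such that $d(\Phi^n(x),\Phi^n(y))<\epsilon$ for all $y$ with $d(x,y)<\delta$ and all $n>0$. *)

(* Defs.v *)
From HB Require Import structures.
From mathcomp Require Import all_boot all_order all_algebra.
From mathcomp Require Import zify.
From mathcomp Require Import all_classical all_reals all_analysis.
Set Implicit Arguments.
Unset Strict Implicit.
Unset Printing Implicit Defensive.
Import Order.TTheory GRing.Theory Num.Theory.
Local Open Scope classical_set_scope.
Local Open Scope ring_scope.

Definition configuration : Type := int -> \bar int.

Definition alphabet : Type :=
  seq_sub [:: -oo%E; (-1)%:E; 0%:E; 1%:E; +oo%E : \bar int].

Definition increment : Type := seq_sub [:: -2; -1; 0; 1; 2 : int].

Definition beta_val (m : int) (n : \bar int) : \bar int :=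
  if ((m + 1)%:E < n)%E then +oo%E
  else if (n < (m - 1)%:E)%E then -oo%E
  else if n is k%:E then (k - m)%:E else n.

Lemma beta_valP (m : int) (n : \bar int) :
  beta_val m n \in [:: -oo%E; (-1)%:E; 0%:E; 1%:E; +oo%E : \bar int].
Proof.
rewrite /beta_val; case: n => [k| |]; rewrite ?ltry ?ltNge ?leNye ?leey //=.
rewrite -!ltNge !lte_fin; case: ifPn => // km; case: ifPn => // mk.
have : (k - m == -1) || (k - m == 0) || (k - m == 1) by lia.
by case/orP => [/orP[]|] /eqP ->.
Qed.

Definition beta (m : int) (n : \bar int) : alphabet := SeqSub (beta_valP m n).

Definition local_rule : Type := alphabet -> alphabet -> increment.

Definition sand_automaton (phi : local_rule) (x : configuration) :
    configuration :=
  fun i => if x i is m%:E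
    then (m + val (phi (beta m (x (i - 1))) (beta m (x (i + 1)))))%:E
    else x i.

Definition latin_square (A S : Type) (t : A -> A -> S) : Prop :=
  (forall L s, exists! R, t L R = s) /\ (forall R s, exists! L, t L R = s).

Definition encode (x : configuration) :
    prod_topology (fun _ : int * int => bool) :=
  fun p => (p.2%:E <= x p.1)%E.

(* Since [encode] is injective, this initial topology is the one making it a
   homeomorphism onto its image. *)
Definition sand_space : topologicalType := initial_topology encode.

Lemma encode_inj : injective encode.
Proof.
move=> x y exy; apply/funext => i.
have E j : (j%:E <= x i)%E = (j%:E <= y i)%E := congr1 (@^~ (i, j)) exy.
move: (x i) (y i) E => [a| |] [b| |] E //.
- congr EFin; have := E a; have := E b; rewrite !lee_fin; lia.
- by have := E (a + 1); rewrite leey lee_fin; lia.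
- by have := E a; rewrite leeNy_eq lee_fin lexx.
- by have := E (b + 1); rewrite leey lee_fin; lia.
- by have := E 0; rewrite leey leeNy_eq.
- by have := E b; rewrite leeNy_eq lee_fin lexx.
- by have := E 0; rewrite leey leeNy_eq.
Qed.

Definition is_metric (R : realType) (T : Type) (d : T -> T -> R) : Prop :=
  [/\ forall x y, 0 <= d x y,
      forall x y, d x y = 0 <-> x = y,
      forall x y, d x y = d y x &
      forall x y z, d x z <= d x y + d y z].

Definition compatible_metric (R : realType) (T : topologicalType)
    (d : T -> T -> R) : Prop :=
  is_metric d /\
  forall U : set T, open U <->
    (forall x, U x -> exists2 r, 0 < r & forall y, d x y < r -> U y).

Definition equicontinuous_map (R : realType) (T : Type) (d : T -> T -> R)
    (F : T -> T) : Prop :=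
  forall x (eps : R), 0 < eps ->
    exists2 delta, 0 < delta &
      forall y, d x y < delta ->
        forall n, (0 < n)%N -> d (iter n F x) (iter n F y) < eps.

(* Main.v *)
Require Import Defs.
From mathcomp Require Import all_boot all_order all_algebra.
From mathcomp Require Import zify.
From mathcomp Require Import all_classical all_reals all_analysis.

(** A column whose two neighbours are infinite is blind to its own height: it
    reads the same pair of letters in [{-oo, +oo}] for ever, and so moves with
    a constant speed [c], one of the entries of the local rule table.  A
    nonzero speed destroys equicontinuity: place the column at [- c * N].  For
    large [N] this configuration is close to the fixed point whose column is
    infinite on the side that the motion leaves, yet after [N + 1] steps the
    column has reached height [c], on the other side of the origin
    ([not_equicontinuous_of_drift]).  In a Latin square the entries for the
    neighbours [(+oo, -oo)] and [(+oo, +oo)] share a row, hence differ, so that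
    one of them is a nonzero speed ([latin_row_nonzero]). *)

Set Implicit Arguments.
Unset Strict Implicit.
Unset Printing Implicit Defensive.
Import Order.TTheory GRing.Theory Num.Theory.
Local Open Scope classical_set_scope.
Local Open Scope ring_scope.

(** The bits of an encoding live in a discrete space, so a coordinate converges
    exactly when it is eventually constant. *)
Lemma sand_cvg (F : set_system sand_space) (x : sand_space) : Filter F ->
  (forall p, \forall y \near F, encode y p = encode x p) -> F --> x.
Proof.
move=> FF Fx.
have cvg_enc : encode @ F --> encode x.
  apply/cvg_sup => p A [_ [[B _ <-] Bx] BA].
  by apply: filterS (Fx p) => y yx; apply: BA; rewrite /= yx.
move=> A [_ [[B Bop <-] Bx] BA].
by apply: filterS BA (cvg_enc B _); apply: open_nbhs_nbhs.
Qed.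

Lemma open_cylinder (p : int * int) (b : bool) :
  open [set x : sand_space | encode x p = b].
Proof.
exists [set f | f p = b] => //.
rewrite openE => f fb.
have /cvg_sup/(_ p) : f --> f by exact: cvg_id.
apply; exists [set g | g p = b]; split => //.
by exists [set b] => //; exact: discrete_open.
Qed.

Section CompatibleMetric.
Context (R : realType) (T : topologicalType) (d : T -> T -> R).
Context (dT : compatible_metric d).

Lemma metric_ball_nbhs x (r : R) : 0 < r -> nbhs x [set y | d x y < r].
Proof.
have [[_ d0 _ dtri] dopen] := dT; move=> r0.
apply: open_nbhs_nbhs; split; last by rewrite /= (d0 x x).2.
apply/dopen => y /= xy; exists (r - d x y); first by rewrite subr_gt0.
by move=> z; rewrite ltrBrDl; apply: le_lt_trans.
Qed.

(** Equicontinuity at a fixed point makes the neighbourhoods of the point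
    uniform in time; for a sequence converging to it this reads as follows. *)
Lemma equicontinuous_fixpoint (F : T -> T) (x : T) (u : nat -> T) (U : set T) :
  equicontinuous_map d F -> F x = x -> u @ \oo --> x -> open U -> U x ->
  \forall N \near \oo, forall n, (0 < n)%N -> U (iter n F (u N)).
Proof.
move=> equiF Fx ux /dT.2 Uopen /Uopen[eps eps0 epsU].
have [delta delta0 close] := equiF x eps eps0.
have u_close : \forall N \near \oo, d x (u N) < delta.
  exact: ux (metric_ball_nbhs x delta0).
apply: filterS u_close => N /close uN n /uN.
by rewrite iter_fix //; exact: epsU.
Qed.

End CompatibleMetric.

(** Used with [r] infinite only: every column but the one at the origin is then
    frozen, and the origin is the only place where something can happen. *)
Definition single_column (r v : \bar int) : configuration :=
  fun i => if i < 0 then +oo%E else if i == 0 then v else r.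

(** The speed of the column at the origin of [single_column r]: an infinite
    neighbour looks the same from every height, so the base point [0] of [beta]
    stands for all of them. *)
Definition drift (phi : local_rule) (r : \bar int) : int :=
  val (phi (beta 0 +oo%E) (beta 0 r)).

Section Drift.
Context (phi : local_rule) (r : \bar int).
Context (r_inf : (r == +oo%E) || (r == -oo%E)).

Lemma beta_inf m (v : \bar int) :
  (v == +oo%E) || (v == -oo%E) -> beta m v = beta 0 v.
Proof.
by move=> /orP[] /eqP->; apply: val_inj; rewrite /= /beta_val ?ltry ?ltNge ?leNye.
Qed.

Lemma sand_single_column m :
  sand_automaton phi (single_column r m%:E) =
  single_column r (m + drift phi r)%:E.
Proof.
apply/funext => i; rewrite /sand_automaton /single_column.
case: ltgtP => // [_|->].
  by case/orP: r_inf => /eqP->.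
by rewrite /= (beta_inf m r_inf) (@beta_inf m +oo%E).
Qed.

Lemma iter_sand_single_column n m :
  iter n (sand_automaton phi) (single_column r m%:E) =
  single_column r (m + drift phi r * n%:Z)%:E.
Proof.
elim: n => [|n IHn]; first by rewrite mulr0 addr0.
by rewrite iterS IHn sand_single_column; congr (single_column r _%:E); lia.
Qed.

Lemma sand_fix_single_column v :
  (v == +oo%E) || (v == -oo%E) ->
  sand_automaton phi (single_column r v) = single_column r v.
Proof.
move=> v_inf; apply/funext => i; rewrite /sand_automaton /single_column.
case: ltgtP => // _; first by case/orP: r_inf => /eqP->.
by case/orP: v_inf => /eqP->.
Qed.

(** The starting heights run off against the sign of [c], so that a motion of
    speed [c] brings them back; a bit at level [j] is settled once [N > `|j|],
    because [`|c| >= 1]. *)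
Lemma cvg_single_column (c : int) : c != 0 ->
  (fun N : nat => single_column r (- c * N%:Z)%:E : sand_space) @ \oo -->
  (single_column r (if c < 0 then +oo%E else -oo%E) : sand_space).
Proof.
move=> c0; apply: sand_cvg => -[i j].
exists `|j|.+1 => // N /= jN; rewrite /encode /single_column /=.
case: ltgtP => // _; case: ltP => c0'; rewrite lee_fin ?leey ?leeNy_eq.
- apply/idP; nia.
- apply/negbTE; nia.
Qed.

Lemma not_equicontinuous_of_drift (R : realType)
    (d : sand_space -> sand_space -> R) :
  compatible_metric d -> drift phi r != 0 ->
  ~ equicontinuous_map d (sand_automaton phi).
Proof.
set c := drift phi r => dX c0 equi.
have fixed := @sand_fix_single_column (if c < 0 then +oo%E else -oo%E).
have := equicontinuous_fixpoint dX equi (fixed _) (cvg_single_column c0)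
  (open_cylinder (0, 0) _) erefl.
case; first by case: ifP.
(* At time [N] the column started at [- c * N] is at height [0], where bit
   [(0, 0)] still has its limit value if [c < 0]; one more step settles both
   signs of [c]. *)
move=> N _ /(_ N (leqnn N) N.+1 isT) /=.
rewrite -iterS iter_sand_single_column /encode /single_column /=.
have -> : - c * N%:Z + drift phi r * N.+1%:Z = c by rewrite -/c; lia.
by case: ltP => c_sign; rewrite lee_fin ?leey ?leeNy_eq ?c_sign // leNgt c_sign.
Qed.

End Drift.

Lemma latin_row_nonzero (phi : local_rule) : latin_square phi ->
  drift phi +oo%E != 0 \/ drift phi -oo%E != 0.
Proof.
move=> [row _]; have [py|] := eqVneq (drift phi +oo%E) 0; last by left.
have [pN|] := eqVneq (drift phi -oo%E) 0; last by right.
have [b [_ b_unique]] := row (beta 0 +oo%E) (phi (beta 0 +oo%E) (beta 0 +oo%E)).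
have : b = beta 0 -oo%E by apply/b_unique/val_inj; exact: etrans pN (esym py).
by rewrite (b_unique (beta 0 +oo%E) erefl) => /(congr1 val).
Qed.

Theorem corollary4p5 (phi : local_rule) (Hphi : latin_square phi)
    (R : realType) (d : sand_space -> sand_space -> R)
    (Hd : compatible_metric d) :
  ~ equicontinuous_map d (sand_automaton phi).
Proof.
by have [] := latin_row_nonzero Hphi; apply: not_equicontinuous_of_drift.
Qed.
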